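(* Let $\Gamma$ be a compact metric graph, $d\ge0$, let $X\subseteq\mathrm{Div}^d_{+,\mathbb R}(\Gamma)$ be tropically convex, and let $T\subseteq X$ be a compact tropically convex subset. Then there exists a tropical retraction of $X$ onto $T$, i.e., a continuous map $h:[0,1]\times X\to X$ such that $h(0,D)=D$ and $h(1,D)\in T$ for all $D\in X$, $h(t,D)=D$ for all $t\in[0,1]$ and $D\in T$, and for every $t\in[0,1]$ the set $h(t,X)$ is tropically convex.
   Context: $\Gamma$ is a compact metric graph (finitely many edges of finite length). An $\mathbb R$-divisor is a finite formal sum $\sum_p m_p(p)$, $m_p\in\mathbb R$, $p\in\Gamma$; effective means all $m_p\ge0$; degree is $\sum m_p$. $\mathrm{Div}^d_{+,\mathbb R}(\Gamma)$ is the set of effective $\mathbb R$-divisors of degree $d$. For a continuous piecewise-linear $f$ on $\Gamma$, $\Delta f=\sum_p\sigma_p(f)(p)$ where $-\sigma_p(f)$ is the sum of the outgoing slopes of $f$ at $p$. For effective $D_1,D_2$ of equal degree, $f_{D_2-D_1}$ is a continuous piecewise-linear function with $\Delta f_{D_2-D_1}=D_2-D_1$ (unique up to additive constant). The metric is $\rho(D_1,D_2)=\max f_{D_2-D_1}-\min f_{D_2-D_1}$; all topological notions (continuity, compactness) refer to it. The tropical segment $\mathrm{tconv}(D_1,D_2)$ is the image of $t\mapsto D_1+\Delta\min(t\rho(D_1,D_2),f_{D_2-D_1}-\min f_{D_2-D_1})$, $t\in[0,1]$. A set is tropically convex if it contains $\mathrm{tconv}(D_1,D_2)$ for any two of its elements.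 *)

(* Defs.v *)
From HB Require Import structures.
From mathcomp Require Import all_boot all_order all_algebra.
From mathcomp Require Import all_classical all_reals all_analysis.

Set Implicit Arguments.
Unset Strict Implicit.
Unset Printing Implicit Defensive.

Import Order.TTheory GRing.Theory Num.Theory.
Import numFieldNormedType.Exports.

Local Open Scope classical_set_scope.
Local Open Scope ring_scope.

(* A compact metric graph, given by a finite model: each edge [e] is a copy of
   the segment [0, len e] whose ends are glued to [src e] and [tgt e].  Loops
   and multiple edges are allowed.  Connectedness is part of the notion: it is
   what makes the potentials below exist and be unique up to a constant. *)
Record metric_graph (R : realType) := MetricGraph {
  vertex : finType ;
  edge : finType ;
  src : edge -> vertex ;
  tgt : edge -> vertex ;
  len : edge -> R ;
  len_gt0 : forall e, 0 < len e ;
  graph_nonempty : (0 < #|vertex|)%N ;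
  graph_connected : forall u v : vertex,
    connect (fun x y => [exists e, ((src e == x) && (tgt e == y))
                                || ((src e == y) && (tgt e == x))]) u v
}.

(* The points of the graph: its vertices, and the pairs (e, t) with t in the
   open segment ]0, len e[. *)
Definition gpoint (R : realType) (G : metric_graph R) : Type :=
  (vertex G + {x : edge G * R | 0 < x.2 < len x.1})%type.

HB.instance Definition _ (R : realType) (G : metric_graph R) :=
  Choice.copy (gpoint G)
    (vertex G + {x : edge G * R | 0 < x.2 < len x.1})%type.

(* Parametrization of the edge [e] by [0, len e] (clamped outside). *)
Definition edge_pt (R : realType) (G : metric_graph R) (e : edge G) (t : R) :
    gpoint G :=
  if t <= 0 then inl (src e)
  else if (insub (e, t) : option {x : edge G * R | 0 < x.2 < len x.1})
       is Some x then inr x else inl (tgt e).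

(* Affineness is required on closed pieces, so that continuity on the graph
   is automatic. *)
Definition piecewise_linear (R : realType) (G : metric_graph R)
    (f : gpoint G -> R) : Prop :=
  forall e : edge G, exists2 s : seq R, itv_partition 0 (len e) s &
    forall i : nat, (i < size s)%N ->
      exists a b : R, forall t : R, nth 0 (0 :: s) i <= t <= nth 0 s i ->
        f (edge_pt e t) = a * t + b.

(* Outgoing slopes at the point of parameter [t] of [e], in the directions of
   [tgt e] and of [src e] respectively. *)
Definition slope_fwd (R : realType) (G : metric_graph R) (f : gpoint G -> R)
    (e : edge G) (t : R) : R :=
  lim ((f (edge_pt e (t + h)) - f (edge_pt e t)) / h @[h --> 0^'+]).

Definition slope_bwd (R : realType) (G : metric_graph R) (f : gpoint G -> R)
    (e : edge G) (t : R) : R :=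
  lim ((f (edge_pt e (t - h)) - f (edge_pt e t)) / h @[h --> 0^'+]).

Definition outgoing_slopes (R : realType) (G : metric_graph R)
    (f : gpoint G -> R) (p : gpoint G) : R :=
  match p with
  | inl v => \sum_(e : edge G | src e == v) slope_fwd f e 0
           + \sum_(e : edge G | tgt e == v) slope_bwd f e (len e)
  | inr x => let: (e, t) := val x in slope_fwd f e t + slope_bwd f e t
  end.

(* Divisors are represented by their coefficient functions. *)
Definition laplacian (R : realType) (G : metric_graph R) (f : gpoint G -> R) :
    gpoint G -> R :=
  fun p => - outgoing_slopes f p.

Record eff_div (R : realType) (G : metric_graph R) (d : R) := EffDiv {
  coef :> gpoint G -> R ;
  coef_finite : finite_set [set p | coef p != 0] ;
  coef_ge0 : forall p, 0 <= coef p ;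
  coef_degree : \sum_(p \in [set: gpoint G]) coef p = d
}.

(* A function f with Delta f = D2 - D1. *)
Definition potential (R : realType) (G : metric_graph R) (d : R)
    (D1 D2 : eff_div G d) : gpoint G -> R :=
  xget (cst 0) [set f | piecewise_linear f /\
                        forall p, laplacian f p = D2 p - D1 p].

(* The sup and inf are attained, the function being continuous on a compact
   space. *)
Definition fmax (T : Type) (R : realType) (f : T -> R) : R := sup (range f).
Definition fmin (T : Type) (R : realType) (f : T -> R) : R := inf (range f).

Definition rho (R : realType) (G : metric_graph R) (d : R)
    (D1 D2 : eff_div G d) : R :=
  fmax (potential D1 D2) - fmin (potential D1 D2).

HB.instance Definition _ (R : realType) (G : metric_graph R) (d : R) :=
  gen_eqMixin (eff_div G d).
HB.instance Definition _ (R : realType) (G : metric_graph R) (d : R) :=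
  gen_choiceMixin (eff_div G d).

(* The metric topology of rho. *)
Definition rho_open (R : realType) (G : metric_graph R) (d : R) :
    set_system (eff_div G d) :=
  [set U | forall D, U D ->
     exists2 eps : R, 0 < eps & [set D' | rho D D' < eps] `<=` U].

Lemma rho_openT (R : realType) (G : metric_graph R) (d : R) :
  rho_open [set: eff_div G d].
Proof. by move=> D _; exists 1. Qed.

Lemma rho_openI (R : realType) (G : metric_graph R) (d : R) :
  setI_closed (@rho_open R G d).
Proof.
move=> U V oU oV D [/oU[a a0 aU] /oV[b b0 bV]].
exists (Num.min a b); first by rewrite lt_min a0.
by move=> D' /=; rewrite lt_min => /andP[/aU ? /bV ?].
Qed.

Lemma rho_open_bigU (R : realType) (G : metric_graph R) (d : R) (I : Type)
    (f : I -> set (eff_div G d)) :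
  (forall i, rho_open (f i)) -> rho_open (\bigcup_i f i).
Proof.
move=> of_ D [i _ /of_[e e0 ef]].
by exists e => // D' /ef ?; exists i.
Qed.

HB.instance Definition _ (R : realType) (G : metric_graph R) (d : R) :=
  isOpenTopological.Build (eff_div G d)
    (@rho_openT R G d) (@rho_openI R G d) (@rho_open_bigU R G d).

Definition tpath (R : realType) (G : metric_graph R) (d : R)
    (D1 D2 : eff_div G d) (t : R) : gpoint G -> R :=
  let f := potential D1 D2 in
  fun p => D1 p +
    laplacian (fun q => Num.min (t * rho D1 D2) (f q - fmin f)) p.

Definition tconv (R : realType) (G : metric_graph R) (d : R)
    (D1 D2 : eff_div G d) : set (gpoint G -> R) :=
  tpath D1 D2 @` `[0, 1].

Definition tropically_convex (R : realType) (G : metric_graph R) (d : R)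
    (X : set (eff_div G d)) : Prop :=
  forall D1 D2, X D1 -> X D2 ->
    tconv D1 D2 `<=` (@coef R G d) @` X.

Definition tropical_retraction (R : realType) (G : metric_graph R) (d : R)
    (X T : set (eff_div G d)) (h : R * eff_div G d -> eff_div G d) : Prop :=
  [/\ {within `[0, 1] `*` X, continuous h},
      forall (t : R) D, 0 <= t <= 1 -> X D -> X (h (t, D)),
      forall D, X D -> h (0, D) = D /\ T (h (1, D)),
      forall (t : R) D, 0 <= t <= 1 -> T D -> h (t, D) = D
    & forall t : R, 0 <= t <= 1 ->
        tropically_convex [set h (t, D) | D in X]].

(* Main.v *)
Require Import Defs.
From HB Require Import structures.
From mathcomp Require Import all_boot all_order all_algebra.
From mathcomp Require Import all_classical all_reals all_analysis.
From mathcomp Require Import ring lra.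

(** Fixing a base divisor [D0], a divisor [D] is encoded by the function
    [F D], unique up to a constant, with [Delta (F D) = D - D0].  Then [rho] is
    the oscillation of [F D2 - F D1], and a set is tropically convex exactly
    when the functions [F D + c] it defines are closed under pointwise minimum.

    By compactness and convexity of [T] there is a least function [U D] among
    the [F E + c], [E] in [T], that dominate [F D].  It is monotone in [F D] and
    commutes with constants, so [U] and [gap D = max (U D - F D)] are Lipschitz.
    The retraction moves [D] to the divisor of [min (F D + a, U D)], where [a]
    is chosen so that the gap becomes [min (gap D) ((1 - t) / t)].  Its image at
    time [t] is therefore the set of [D] in [X] with [t (1 + gap D) <= 1], which
    is convex because [F D <= F E + c <= F D + r] is stable under minima.

    The potentials exist because tent functions push the interior points of a
    divisor to the ends of their edges, where the vertex Laplacian is onto the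
    vectors of sum zero; uniqueness is the maximum principle. *)

Set Implicit Arguments.
Unset Strict Implicit.
Unset Printing Implicit Defensive.

Import Order.TTheory GRing.Theory Num.Theory.
Import numFieldNormedType.Exports.

Local Open Scope classical_set_scope.
Local Open Scope ring_scope.

(** * Piecewise linear functions of one variable *)

Section Germs.
Context {R : realType}.
Implicit Types (phi psi g : R -> R) (y a l : R).

(** Exact agreement with an affine function just to the right of 0. The value [y] is prescribed, so
    continuity is built in; backward directions are read through [fun h => g (t - h)]. *)
Definition germ phi y a : Prop := \forall h \near 0^'+, phi h = y + a * h.

Lemma germ_ex phi y a : germ phi y a <->
  exists2 e, 0 < e & forall h, 0 < h < e -> phi h = y + a * h.
Proof.
split.
  move=> [e /= e0 H]; exists e => // h /andP[h0 he].
  by apply: H => //=; rewrite sub0r normrN gtr0_norm.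
move=> [e e0 H]; near=> h; apply: H; apply/andP; split => //.
Unshelve. all: by end_near. Qed.

Lemma germ_lim phi y a : germ phi y a -> lim ((phi h - y) / h @[h --> 0^'+]) = a.
Proof.
move=> H; apply: cvg_lim => //; apply: cvg_near_cst.
near=> h; have h0 : 0 < h by [].
rewrite (near H h) //; first by field; rewrite gt_eqF.
Unshelve. all: by end_near. Qed.

Lemma germD phi psi y z a b : germ phi y a -> germ psi z b ->
  germ (fun h => phi h + psi h) (y + z) (a + b).
Proof. by move=> H K; near=> h; rewrite (near H h) // (near K h) //; ring.
Unshelve. all: by end_near. Qed.

Lemma germZ k phi y a : germ phi y a -> germ (fun h => k * phi h) (k * y) (k * a).
Proof. by move=> H; near=> h; rewrite (near H h) //; ring.
Unshelve. all: by end_near. Qed.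

Lemma germ_cst y : germ (fun=> y) y 0.
Proof. by near=> h; rewrite mul0r addr0.
Unshelve. all: by end_near. Qed.

(** Near 0 the function with the lexicographically smaller pair (value, slope) stays below the
    other. *)
Lemma germ_min phi psi y z a b : germ phi y a -> germ psi z b ->
  exists c, germ (fun h => Num.min (phi h) (psi h)) (Num.min y z) c.
Proof.
wlog: phi psi y z a b / (y < z) || ((y == z) && (a <= b)) => [W H K|].
  have [C|C] := boolP ((y < z) || ((y == z) && (a <= b))); first exact: W C H K.
  have [|c Hc] := W _ _ _ _ _ _ _ K H.
    move: C; rewrite negb_or negb_and -leNgt le_eqVlt => /andP[/orP[/eqP ->|->//]].
    by rewrite eqxx /= -ltNge => /ltW ->; rewrite orbT.
  by exists c; rewrite minC; under eq_fun do rewrite minC.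
move=> yz H K; exists a.
have -> : Num.min y z = y by apply: min_l; case/orP: yz => [/ltW//|/andP[/eqP->]].
case/orP: yz => [yz|/andP[/eqP yz ab]]; last first.
  near=> h; have h0 : 0 < h by [].
  by rewrite (near H h) // (near K h) // yz; apply: min_l; rewrite lerD2l ler_wpM2r // ltW.
(* The added 1 keeps the denominator positive when the slopes agree. *)
have k0 : 0 < 1 + `|a - b| by rewrite ltr_pwDl.
near=> h; have h0 : 0 < h by [].
rewrite (near H h) // (near K h) //; apply: min_l.
have hz : h < (z - y) / (1 + `|a - b|).
  by near: h; apply: nbhs_right_lt; rewrite divr_gt0 ?subr_gt0.
move: hz; rewrite ltr_pdivlMr // => hz.
have : (a - b) * h <= `|a - b| * h by apply: ler_wpM2r; [exact: ltW|exact: ler_norm].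
lra.
Unshelve. all: by end_near. Qed.

(** The supremum of the [x] such that [P] holds on [0, x] belongs to that set and cannot stop short
    of [l]. *)
Lemma real_induction l (P : R -> Prop) : 0 <= l -> P 0 ->
  (forall x, 0 <= x < l -> P x ->
     exists2 e, 0 < e & forall y, x < y < x + e -> y <= l -> P y) ->
  (forall x, 0 < x <= l -> (forall y, 0 <= y < x -> P y) -> P x) -> P l.
Proof.
move=> l0 P0 Pr Pl.
pose S := [set x | 0 <= x <= l /\ forall y, 0 <= y <= x -> P y].
have S0 : S 0.
  split; first by rewrite lexx.
  by move=> y /andP[y0 y0']; rewrite (_ : y = 0) //; apply/le_anti/andP.
have Sl : ubound S l by move=> x [/andP[]].
have hS : has_sup S by split; [exists 0|exists l].
set s := sup S.
have sl : s <= l by apply: ge_sup => //; exists 0.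
have s0 : 0 <= s by apply: ub_le_sup => //; exists l.
have Plt y : 0 <= y < s -> P y.
  move=> /andP[y0 ys]; have e0 : 0 < s - y by rewrite subr_gt0.
  have [x [_ Px]] := sup_adherent e0 hS.
  by rewrite -/s subKr => yx; apply: Px; rewrite y0 ltW.
have Ps : P s.
  move: s0; rewrite le_eqVlt => /orP[/eqP <- //|s0].
  by apply: Pl => //; rewrite s0.
move: sl; rewrite le_eqVlt => /orP[/eqP <- //|sl'].
have [|e e0 H] := Pr s _ Ps; first by rewrite s0.
pose x := Num.min l (s + e / 2).
have sx : s < x by rewrite lt_min sl' ltrDl divr_gt0.
suff : S x by move/(ub_le_sup (ex_intro _ l Sl)); rewrite leNgt sx.
split; first by rewrite ge_min lexx andbT ltW// (le_lt_trans s0).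
move=> y /andP[y0 yx].
have [ys|ys|->//] := ltgtP y s; first by apply: Plt; rewrite y0.
move: yx; rewrite le_min => /andP[yl yx]; apply: H => //; lra.
Qed.

(** Piecewise linearity stated point by point: it passes to sums and minima without a common
    subdivision, and compactness gives back a finite one. *)
Definition germs_on g l : Prop :=
  (forall t, 0 <= t < l -> exists a, germ (fun h => g (t + h)) (g t) a) /\
  (forall t, 0 < t <= l -> exists a, germ (fun h => g (t - h)) (g t) a).

(** Real induction acts as compactness: every point has one-sided neighbourhoods where [g] is
    affine, so only the passage across one affine piece has to be checked. *)
Lemma affine_chain g l (P : R -> Prop) : 0 <= l -> germs_on g l -> P 0 ->
  (forall x y a b, 0 <= x -> x < y -> y <= l ->
    (forall t, x <= t <= y -> g t = a * t + b) -> P x -> P y) -> P l.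
Proof.
move=> l0 [gr gl] P0 step; apply: real_induction l0 P0 _ _.
  move=> x xl Px; have [a /germ_ex[e e0 ge]] := gr x xl.
  exists e => // y /andP[xy ye] yl; case/andP: xl => x0 xl.
  apply: (step x y a (g x - a * x)) => // t /andP[xt ty].
  move: xt; rewrite le_eqVlt => /orP[/eqP<-|xt]; first by ring.
  rewrite -{1}[t](addrNK x) addrC ge; last by lra.
  by rewrite [_ - x]addrC; ring.
move=> x xl Px; have [a /germ_ex[e e0 ge]] := gl x xl; case/andP: xl => x0 xl.
(* The germ is known only strictly after [x - e], so the piece starts half way; the maximum keeps it
   inside the interval. *)
pose y := Num.max 0 (x - e / 2).
have yx : y < x by rewrite gt_max x0; lra.
have y0 : 0 <= y by rewrite le_max lexx.
have ye : x - e / 2 <= y by rewrite le_max lexx orbT.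
apply: (step y x (- a) (g x + a * x)) => //; last by apply: Px; rewrite y0.
move=> t /andP[yt]; rewrite le_eqVlt => /orP[/eqP->|tx]; first by ring.
have -> : t = x - (x - t) by ring.
rewrite ge; [ring|lra].
Qed.

Lemma germs_on_bounded g l : 0 <= l -> germs_on g l ->
  exists M, forall t, 0 <= t <= l -> `|g t| <= M.
Proof.
move=> l0 gg.
apply: (@affine_chain g l (fun x => exists M, forall t, 0 <= t <= x -> `|g t| <= M)) => //.
  exists `|g 0| => t /andP[t0 t0']; rewrite (_ : t = 0) //; exact/le_anti/andP.
move=> x y a b x0 xy yl gab [M HM].
exists (Num.max M (`|a| * y + `|b|)) => t /andP[t0 ty].
rewrite le_max; have [tx|tx] := leP t x; first by rewrite HM ?t0.
rewrite gab; last by rewrite (ltW tx).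
apply/orP; right.
rewrite (le_trans (ler_normD _ _))// lerD2r normrM ler_wpM2l // ger0_norm //.
Qed.

Lemma germs_on_partition g l : 0 <= l -> germs_on g l ->
  exists2 s : seq R, itv_partition 0 l s &
    forall i : nat, (i < size s)%N ->
      exists a b : R, forall t : R, nth 0 (0 :: s) i <= t <= nth 0 s i ->
        g t = a * t + b.
Proof.
move=> l0 gg.
apply: (@affine_chain g l (fun x => exists2 s : seq R, itv_partition 0 x s &
    forall i : nat, (i < size s)%N ->
      exists a b : R, forall t : R, nth 0 (0 :: s) i <= t <= nth 0 s i ->
        g t = a * t + b)) => //; first by exists [::] => //; split.
move=> x y a b x0 xy yl gab [s [sp /eqP sx] H].
exists (rcons s y); first by split; rewrite ?rcons_path ?last_rcons ?sp ?sx.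
move=> i; rewrite size_rcons ltnS leq_eqVlt => /orP[/eqP->|si].
  exists a, b => t; rewrite -rcons_cons !nth_rcons /= ltnSn ltnn eqxx => tt.
  by apply: gab; move: tt; rewrite -sx -nth_last /=; case: (s).
have [a' [b' H']] := H i si; exists a', b' => t.
by rewrite -rcons_cons !nth_rcons /= si ltnS (ltnW si); exact: H'.
Qed.

(** The piece is half-open so as to leave room for a germ to the right of [t]; [partition_left] is
    the mirror image. *)
Lemma partition_right (s : seq R) x t : path <%R x s -> x <= t < last x s ->
  exists2 i : nat, (i < size s)%N & nth 0 (x :: s) i <= t < nth 0 s i.
Proof.
elim: s x => [|y s IH] x /=; first by move=> _; case: ltgtP.
move=> /andP[xy sp] /andP[xt tl].
have [ty|yt] := ltP t y; first by exists 0%N => //=; rewrite xt.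
by have [|i si H] := IH _ sp; [rewrite yt|exists i.+1].
Qed.

Lemma partition_left (s : seq R) x t : path <%R x s -> x < t <= last x s ->
  exists2 i : nat, (i < size s)%N & nth 0 (x :: s) i < t <= nth 0 s i.
Proof.
elim: s x => [|y s IH] x /=; first by move=> _; case: ltgtP.
move=> /andP[xy sp] /andP[xt tl].
have [ty|yt] := leP t y; first by exists 0%N => //=; rewrite xt.
by have [|i si H] := IH _ sp; [rewrite yt|exists i.+1].
Qed.

Lemma partition_germs_on g l s : itv_partition 0 l s ->
  (forall i : nat, (i < size s)%N ->
      exists a b : R, forall t : R, nth 0 (0 :: s) i <= t <= nth 0 s i ->
        g t = a * t + b) -> germs_on g l.
Proof.
move=> [sp /eqP sl] H; split => t; rewrite -sl => tl.
  have [i si /andP[ti it]] := partition_right sp tl.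
  have [a [b ab]] := H i si; exists a; apply/germ_ex.
  exists (nth 0 s i - t); first by rewrite subr_gt0.
  by move=> h hh; rewrite !ab; [ring|lra|lra].
have [i si /andP[ti it]] := partition_left sp tl.
have [a [b ab]] := H i si; exists (- a); apply/germ_ex.
exists (t - nth 0 (0 :: s) i); first by rewrite subr_gt0.
by move=> h hh; rewrite !ab; [ring|lra|lra].
Qed.

(* Opposite one-sided slopes at interior points forbid any break. *)
Lemma germs_on_affine g l : 0 <= l -> germs_on g l ->
  (forall t a b, 0 < t < l -> germ (fun h => g (t + h)) (g t) a ->
     germ (fun h => g (t - h)) (g t) b -> a + b = 0) ->
  exists a, forall t, 0 <= t <= l -> g t = g 0 + a * t.
Proof.
move=> l0 gg Hs.
apply: (@affine_chain g l (fun x => exists a, forall t, 0 <= t <= x -> g t = g 0 + a * t)) => //.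
  by exists 0 => t /andP[t0 t0']; rewrite (_ : t = 0) ?mul0r ?addr0 //; exact/le_anti/andP.
move=> x y a b x0 xy yl gab [s Hx].
have gx : germ (fun h => g (x + h)) (g x) a.
  apply/germ_ex; exists (y - x); first by rewrite subr_gt0.
  by move=> h hh; rewrite !gab; [ring|lra|lra].
move: x0; rewrite le_eqVlt => /orP[/eqP x0|x0].
  exists a => t; rewrite {1}x0 => tt; rewrite (gab t) // x0 (gab x) ?lexx ?(ltW xy) //.
  by rewrite -x0; ring.
have gx' : germ (fun h => g (x - h)) (g x) (- s).
  by apply/germ_ex; exists x => // h hh; rewrite (Hx (x - h)) ?(Hx x); [ring|lra|lra].
have as_ : a = s.
  by apply/eqP; rewrite -subr_eq0; apply/eqP/(Hs x) => //; rewrite x0 (lt_le_trans xy).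
exists s => t /andP[t0 ty].
have [tx|xt] := leP t x; first by apply: Hx; rewrite t0.
have := Hx x; rewrite gab ?lexx ?(ltW xy)// (ltW x0) => /(_ isT) e.
rewrite gab ?ty ?(ltW xt) //; rewrite -as_ in e *; lra.
Qed.

End Germs.

(** * Piecewise linear functions on the graph *)

Section LocallyLinear.
Context {R : realType} {G : metric_graph R}.
Implicit Types (f g : gpoint G -> R) (e : edge G).

Lemma edge_pt0 e : edge_pt e 0 = inl (src e).
Proof. by rewrite /edge_pt lexx. Qed.

Lemma edge_pt_len e : edge_pt e (len e) = inl (tgt e).
Proof.
by rewrite /edge_pt leNgt len_gt0 /= insubF //= ltxx andbF.
Qed.

Lemma edge_pt_in (x : {x : edge G * R | 0 < x.2 < len x.1}) :
  edge_pt (val x).1 (val x).2 = inr x.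
Proof.
case: x => -[e t] /= H; rewrite /edge_pt; case/andP: (H) => t0 _.
by rewrite leNgt t0 /= insubT.
Qed.

Definition locally_linear f := forall e, germs_on (fun t => f (edge_pt e t)) (len e).

Lemma piecewise_linearP f : piecewise_linear f <-> locally_linear f.
Proof.
split=> H e; first by have [s sp] := H e; exact: partition_germs_on sp.
by apply: germs_on_partition (H e); rewrite ltW ?len_gt0.
Qed.

Lemma locally_linear_cst (c : R) : locally_linear (fun=> c).
Proof. by move=> e; split=> t _; exists 0; exact: germ_cst. Qed.

Lemma locally_linearD f g : locally_linear f -> locally_linear g ->
  locally_linear (fun q => f q + g q).
Proof.
move=> F H e; have [[F1 F2] [H1 H2]] := (F e, H e).
split=> t tl.
  by have [[a ?] [b ?]] := (F1 t tl, H1 t tl); exists (a + b); exact: germD.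
by have [[a ?] [b ?]] := (F2 t tl, H2 t tl); exists (a + b); exact: germD.
Qed.

Lemma locally_linearZ k f : locally_linear f -> locally_linear (fun q => k * f q).
Proof.
move=> F e; have [F1 F2] := F e.
split=> t tl.
  by have [a ?] := F1 t tl; exists (k * a); exact: germZ.
by have [a ?] := F2 t tl; exists (k * a); exact: germZ.
Qed.

Lemma locally_linear_min f g : locally_linear f -> locally_linear g ->
  locally_linear (fun q => Num.min (f q) (g q)).
Proof.
move=> F H e; have [[F1 F2] [H1 H2]] := (F e, H e).
split=> t tl.
  by have [[a ga] [b gb]] := (F1 t tl, H1 t tl); exact: germ_min ga gb.
by have [[a ga] [b gb]] := (F2 t tl, H2 t tl); exact: germ_min ga gb.
Qed.

Lemma slope_fwdE f e t a :
  germ (fun h => f (edge_pt e (t + h))) (f (edge_pt e t)) a -> slope_fwd f e t = a.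
Proof. exact: germ_lim. Qed.

Lemma slope_bwdE f e t a :
  germ (fun h => f (edge_pt e (t - h))) (f (edge_pt e t)) a -> slope_bwd f e t = a.
Proof. exact: germ_lim. Qed.

Lemma slope_fwdD f g e t : locally_linear f -> locally_linear g ->
  0 <= t < len e ->
  slope_fwd (fun q => f q + g q) e t = slope_fwd f e t + slope_fwd g e t.
Proof.
move=> F H tl; have [[F1 _] [H1 _]] := (F e, H e).
have [[a ga] [b gb]] := (F1 t tl, H1 t tl).
by rewrite (slope_fwdE ga) (slope_fwdE gb); apply/slope_fwdE/germD.
Qed.

Lemma slope_bwdD f g e t : locally_linear f -> locally_linear g ->
  0 < t <= len e ->
  slope_bwd (fun q => f q + g q) e t = slope_bwd f e t + slope_bwd g e t.
Proof.
move=> F H tl; have [[_ F1] [_ H1]] := (F e, H e).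
have [[a ga] [b gb]] := (F1 t tl, H1 t tl).
by rewrite (slope_bwdE ga) (slope_bwdE gb); apply/slope_bwdE/germD.
Qed.

Lemma slope_fwdZ k f e t : locally_linear f -> 0 <= t < len e ->
  slope_fwd (fun q => k * f q) e t = k * slope_fwd f e t.
Proof.
move=> F tl; have [F1 _] := F e; have [a ga] := F1 t tl.
by rewrite (slope_fwdE ga); apply/slope_fwdE/germZ.
Qed.

Lemma slope_bwdZ k f e t : locally_linear f -> 0 < t <= len e ->
  slope_bwd (fun q => k * f q) e t = k * slope_bwd f e t.
Proof.
move=> F tl; have [_ F1] := F e; have [a ga] := F1 t tl.
by rewrite (slope_bwdE ga); apply/slope_bwdE/germZ.
Qed.

Lemma laplacianD f g p : locally_linear f -> locally_linear g ->
  laplacian (fun q => f q + g q) p = laplacian f p + laplacian g p.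
Proof.
move=> F H; rewrite /laplacian -opprD; congr (- _).
case: p => [v|[[e t] /= tl]] /=.
  under eq_bigr do rewrite slope_fwdD ?lexx ?len_gt0 //.
  under [X in _ + X = _]eq_bigr do rewrite slope_bwdD ?lexx ?len_gt0 //.
  by rewrite !big_split /=; ring.
case/andP: tl => t0 tl.
by rewrite slope_fwdD ?slope_bwdD ?t0 ?tl ?ltW //; ring.
Qed.

Lemma laplacianZ k f p : locally_linear f ->
  laplacian (fun q => k * f q) p = k * laplacian f p.
Proof.
move=> F; rewrite /laplacian mulrN; congr (- _).
case: p => [v|[[e t] /= tl]] /=.
  under eq_bigr do rewrite slope_fwdZ ?lexx ?len_gt0 //.
  under [X in _ + X = _]eq_bigr do rewrite slope_bwdZ ?lexx ?len_gt0 //.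
  by rewrite mulrDr !mulr_sumr.
case/andP: tl => t0 tl.
by rewrite slope_fwdZ ?slope_bwdZ ?t0 ?tl ?ltW // mulrDr.
Qed.

Lemma laplacian_cst (c : R) (p : gpoint G) : laplacian (fun=> c) p = 0.
Proof.
have fw (e : edge G) t : slope_fwd (fun=> c) e t = 0 by apply/slope_fwdE/germ_cst.
have bw (e : edge G) t : slope_bwd (fun=> c) e t = 0 by apply/slope_bwdE/germ_cst.
rewrite /laplacian; case: p => [v|[[e t] /= tl]] /=; last by rewrite fw bw addr0 oppr0.
by rewrite !big1 ?addr0 ?oppr0.
Qed.

Lemma locally_linear_bounded f : locally_linear f ->
  exists M, forall q, `|f q| <= M.
Proof.
move=> F.
have /choice[m Hm] : forall e, exists M, forall t, 0 <= t <= len e -> `|f (edge_pt e t)| <= M.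
  by move=> e; apply: germs_on_bounded (F e); rewrite ltW ?len_gt0.
(* All terms are nonnegative, so the total dominates each vertex value and each edge bound. *)
exists (\sum_v `|f (inl v)| + \sum_e `|m e|) => -[v|x].
  rewrite (bigD1 v) //= -addrA lerDl addr_ge0 ?sumr_ge0 //.
rewrite -edge_pt_in; set e := (val x).1; set t := (val x).2.
have /Hm H : 0 <= t <= len e by rewrite /t /e; case: (x) => /= y /andP[? ?]; rewrite !ltW.
apply: le_trans H _; apply: le_trans (ler_norm _) _.
by rewrite addrC (bigD1 e) //= -addrA lerDl addr_ge0 ?sumr_ge0.
Qed.

End LocallyLinear.

(** * The discrete Laplacian on the vertices *)

Section VertexLaplacian.
Context {R : realType} {G : metric_graph R}.
Implicit Types (u b : vertex G -> R).

(** The weighted graph Laplacian with conductances [1 / len e], with the sign of outgoing slopes,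
    hence opposite to [laplacian]. *)
Definition vlap u (v : vertex G) : R :=
  \sum_(e : edge G | src e == v) (u (tgt e) - u (src e)) / len e
  + \sum_(e : edge G | tgt e == v) (u (src e) - u (tgt e)) / len e.

(* Maximum principle: the set where [u] is maximal is closed under adjacency. *)
Lemma harmonic_cst u : (forall v, vlap u v = 0) -> forall v w, u v = u w.
Proof.
move=> H; have [v0 _] : exists v0 : vertex G, v0 \in predT.
  by apply/card_gt0P; exact: graph_nonempty.
pose v1 := [arg max_(v > v0) u v]%O.
have v1max v : u v <= u v1 by rewrite /v1; case: arg_maxP => // i _; apply.
suff K w : u w = u v1 by move=> v w; rewrite !K.
have /connectP[p] := graph_connected v1 w.
suff : forall x, u x = u v1 -> path (fun x y => [exists e, ((src e == x) && (tgt e == y))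
                                || ((src e == y) && (tgt e == x))]) x p -> u (last x p) = u v1.
  by move=> Q Hp ->; exact: Q.
elim: p => //= y p IH x ux /andP[/existsP[e He] Hp]; apply: IH Hp.
have n0 (a b : R) (e' : edge G) : b <= a -> 0 <= (a - b) / len e'.
  by move=> ab; rewrite divr_ge0 ?subr_ge0 // ltW ?len_gt0.
(* After negation all terms at a maximum are nonnegative, so each of them vanishes. *)
have := H x; rewrite /vlap => /(congr1 -%R); rewrite oppr0 opprD -!sumrN => /eqP.
under eq_bigr do rewrite -mulNr opprB.
under [X in _ + X]eq_bigr do rewrite -mulNr opprB.
have p1 (e' : edge G) : src e' == x -> 0 <= (u (src e') - u (tgt e')) / len e'.
  by move=> /eqP ->; rewrite ux n0.
have p2 (e' : edge G) : tgt e' == x -> 0 <= (u (tgt e') - u (src e')) / len e'.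
  by move=> /eqP ->; rewrite ux n0.
rewrite paddr_eq0; [|exact: sumr_ge0|exact: sumr_ge0] => /andP[/eqP s1 /eqP s2].
have ln e' : (@len R G e')^-1 != 0 by rewrite invr_eq0 gt_eqF ?len_gt0.
case/orP: He => /andP[es et].
  have /eqP := psumr_eq0P p1 s1 es.
  by rewrite mulf_eq0 (negbTE (ln e)) orbF subr_eq0 (eqP es) (eqP et) ux => /eqP.
have /eqP := psumr_eq0P p2 s2 et.
by rewrite mulf_eq0 (negbTE (ln e)) orbF subr_eq0 (eqP es) (eqP et) ux => /eqP.
Qed.

(** Double counting: each edge is met once from its source and once from its target, a loop twice at
    the same vertex. *)
Lemma sum_ends (A B : edge G -> R) :
  \sum_v (\sum_(e : edge G | src e == v) A e + \sum_(e : edge G | tgt e == v) B e)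
  = \sum_e (A e + B e).
Proof.
rewrite big_split [RHS]big_split /=; congr (_ + _).
  by rewrite [RHS](partition_big (@src R G) predT).
by rewrite [RHS](partition_big (@tgt R G) predT).
Qed.

Let n := #|vertex G|.

Definition vlap_row (r : 'rV[R]_n) : 'rV[R]_n :=
  \row_i vlap (fun v => r 0 (enum_rank v)) (enum_val i).

Fact vlap_row_linear : linear vlap_row.
Proof.
move=> a r s; apply/rowP => i; rewrite !mxE /vlap mulrDr !mulr_sumr addrACA -!big_split /=.
by congr (_ + _); apply: eq_bigr => e _; rewrite !mxE; ring.
Qed.

HB.instance Definition _ := GRing.isLinear.Build R 'rV[R]_n 'rV[R]_n _ vlap_row vlap_row_linear.

(** Rank count: the kernel consists of constants, so the rank is at least [n - 1], the dimension of
    the space of vectors of sum zero, which contains the image. *)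
Lemma vlap_surj b : \sum_v b v = 0 -> exists u, forall v, vlap u v = b v.
Proof.
move=> b0; pose M := lin1_mx vlap_row.
have n_gt0 : (0 < n)%N := graph_nonempty G.
have sumE (F : vertex G -> R) : \sum_(i < n) F (enum_val i) = \sum_v F v.
  by rewrite [RHS](reindex (fun i : 'I_n => enum_val i)) //; exact/onW_bij/enum_val_bij.
have rK : (\rank (kermx M) <= 1)%N.
  apply: leq_trans (rank_leq_row (const_mx 1 : 'rV[R]_n)); apply: mxrankS.
  apply/row_subP => i; set r := row i _.
  have : r *m M = 0 by apply/sub_kermxP; rewrite row_sub.
  rewrite mul_rV_lin1 /= => /rowP r0.
  have rc : forall v w, r 0 (enum_rank v) = r 0 (enum_rank w).
    apply: harmonic_cst => v; have := r0 (enum_rank v).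
    by rewrite !mxE enum_rankK.
  have -> : r = r 0 (Ordinal n_gt0) *: const_mx 1.
    apply/rowP => j; rewrite !mxE mulr1.
    by have := rc (enum_val j) (enum_val (Ordinal n_gt0)); rewrite !enum_valK !mxE.
  exact/scalemx_sub.
pose c : 'cV[R]_n := const_mx 1.
(* The contributions of an edge to its two ends cancel, so images have sum zero. *)
have MK : (M <= kermx c)%MS.
  apply/sub_kermxP/row_matrixP => i; rewrite row_mul rowE mul_rV_lin1 row0.
  apply/matrixP => k l; rewrite !mxE.
  under eq_bigr do rewrite !mxE mulr1.
  rewrite (sumE (vlap _)).
  rewrite sum_ends big1 // => e _; rewrite -mulrDl.
  by rewrite addrC -[X in _ + X]opprB addrN mul0r.
have rc : \rank c = 1%N.
  apply/eqP; rewrite eqn_leq rank_leq_col lt0n mxrank_eq0.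
  by apply/eqP => /matrixP/(_ (Ordinal n_gt0) 0); rewrite !mxE => /eqP; rewrite oner_eq0.
have KM : (kermx c <= M)%MS.
  rewrite -(geq_leqif (mxrank_leqif_sup MK)) mxrank_ker rc.
  by move: rK; rewrite mxrank_ker !leq_subLR addnC.
have : (\row_i b (enum_val i) <= M)%MS.
  apply: submx_trans KM; apply/sub_kermxP/matrixP => k l; rewrite !mxE.
  under eq_bigr do rewrite !mxE mulr1.
  by rewrite sumE.
move=> /submxP[r]; rewrite mul_rV_lin1 => /rowP rE.
exists (fun v => r 0 (enum_rank v)) => v.
by have := rE (enum_rank v); rewrite !mxE enum_rankK.
Qed.

End VertexLaplacian.

(** * The Poisson equation *)

Section Poisson.
Context {R : realType} {G : metric_graph R}.
Implicit Types (f g : gpoint G -> R) (e : edge G).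

(** Without breaks inside edges, [f] is affine on each edge, its slopes are the difference quotients
    of its vertex values, and these values are harmonic for [vlap]. *)
Lemma harmonic_locally_linear_cst f : locally_linear f ->
  (forall p, laplacian f p = 0) -> forall p q, f p = f q.
Proof.
move=> F H.
have aff e : exists a, forall t, 0 <= t <= len e ->
    f (edge_pt e t) = f (inl (src e)) + a * t.
  rewrite -edge_pt0; apply: germs_on_affine (F e) _; first by rewrite ltW ?len_gt0.
  move=> t a b tl ga gb.
  have := H (edge_pt e t); rewrite (edge_pt_in (exist _ (e, t) tl : {x : edge G * R | 0 < x.2 < len x.1})) /=.
  by rewrite /laplacian /= (slope_fwdE ga) (slope_bwdE gb) => /eqP; rewrite oppr_eq0 => /eqP.
have le0 e : 0 <= len e by rewrite ltW ?len_gt0.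
have slope e a : (forall t, 0 <= t <= len e -> f (edge_pt e t) = f (inl (src e)) + a * t) ->
    a = (f (inl (tgt e)) - f (inl (src e))) / len e.
  move=> /(_ (len e)); rewrite le0 lexx edge_pt_len => /(_ isT) ->.
  by field; rewrite gt_eqF ?len_gt0.
have vc : forall v w, f (inl v) = f (inl w).
  apply: (harmonic_cst (u := fun v => f (inl v))) => v.
  have := H (inl v); rewrite /laplacian /= => /eqP; rewrite oppr_eq0 => /eqP hv; apply: etrans hv.
  congr (_ + _); apply: eq_bigr => e _; have [a Ha] := aff e.
    rewrite -(slope _ _ Ha); symmetry; apply: slope_fwdE; apply/germ_ex.
    exists (len e); first exact: len_gt0.
    by move=> h /andP[h0 hl]; rewrite !Ha ?lexx ?add0r ?le0 ?(ltW h0) ?(ltW hl) //; ring.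
  rewrite -opprB mulNr -(slope _ _ Ha); symmetry; apply: slope_bwdE; apply/germ_ex.
  exists (len e); first exact: len_gt0.
  by move=> h /andP[h0 hl]; rewrite !Ha ?lexx ?le0 //; [ring|lra].
suff K p : exists v, f p = f (inl v).
  by move=> p q; have [[v ->] [w ->]] := (K p, K q).
case: p => [v|x]; first by exists v.
exists (src (val x).1); rewrite -edge_pt_in; have [a Ha] := aff (val x).1.
have : 0 <= (val x).2 <= len (val x).1.
  by case: (x) => /= y /andP[? ?]; rewrite !ltW.
move/Ha ->; rewrite (slope _ _ Ha) (vc _ (src (val x).1)) subrr mul0r mul0r addr0 //.
Qed.

(** Each [phi e] is read on the open edge only; the compatibility conditions [phi0] and [phil]
    extend the formula to the closed edge. *)
Definition glue (u : vertex G -> R) (phi : edge G -> R -> R) (q : gpoint G) : R :=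
  match q with inl v => u v | inr x => phi (val x).1 (val x).2 end.

Section Glue.
Variables (u : vertex G -> R) (phi : edge G -> R -> R).
Hypotheses (phi0 : forall e, phi e 0 = u (src e))
           (phil : forall e, phi e (len e) = u (tgt e)).

Lemma glue_edge e t : 0 <= t <= len e -> glue u phi (edge_pt e t) = phi e t.
Proof.
case/andP; rewrite le_eqVlt => /orP[/eqP<- _|t0]; first by rewrite edge_pt0 phi0.
rewrite le_eqVlt => /orP[/eqP->|tl]; first by rewrite edge_pt_len phil.
have H : 0 < (e, t).2 < len (e, t).1 by rewrite t0.
by rewrite (edge_pt_in (exist _ (e, t) H : {x : edge G * R | 0 < x.2 < len x.1})).
Qed.

Lemma glue_fwd e t a : 0 <= t < len e -> germ (fun h => phi e (t + h)) (phi e t) a ->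
  germ (fun h => glue u phi (edge_pt e (t + h))) (glue u phi (edge_pt e t)) a.
Proof.
(* The bound [len e - t] keeps [t + h] on the edge, where the gluing formula is valid. *)
move=> /andP[t0 tl] /germ_ex[d d0 H]; apply/germ_ex; exists (Num.min d (len e - t)).
  by rewrite lt_min d0 subr_gt0.
move=> h; rewrite lt_min => /and3P[h0 hd hl].
by rewrite !glue_edge ?H ?h0 ?t0 ?(ltW tl) //; lra.
Qed.

Lemma glue_bwd e t a : 0 < t <= len e -> germ (fun h => phi e (t - h)) (phi e t) a ->
  germ (fun h => glue u phi (edge_pt e (t - h))) (glue u phi (edge_pt e t)) a.
Proof.
move=> /andP[t0 tl] /germ_ex[d d0 H]; apply/germ_ex; exists (Num.min d t).
  by rewrite lt_min d0.
move=> h; rewrite lt_min => /and3P[h0 hd hl].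
by rewrite !glue_edge ?H ?h0 ?tl ?(ltW t0) //; lra.
Qed.

End Glue.

(** Interpolating affinely on each edge turns the terms of [vlap] into outgoing slopes and creates
    no break inside edges. *)
Lemma interpolation (u : vertex G -> R) : exists f,
  [/\ locally_linear f, forall v, laplacian f (inl v) = - vlap u v
    & forall x, laplacian f (inr x) = 0].
Proof.
pose s e := (u (tgt e) - u (src e)) / len e.
pose phi e t := u (src e) + s e * t.
have phi0 e : phi e 0 = u (src e) by rewrite /phi mulr0 addr0.
have phil e : phi e (len e) = u (tgt e).
  by rewrite /phi /s; field; rewrite gt_eqF ?len_gt0.
have gf e t : 0 <= t < len e -> germ (fun h => glue u phi (edge_pt e (t + h)))
    (glue u phi (edge_pt e t)) (s e).
  by move=> /(glue_fwd phi0 phil); apply; near=> h; rewrite /phi; ring.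
have gb e t : 0 < t <= len e -> germ (fun h => glue u phi (edge_pt e (t - h)))
    (glue u phi (edge_pt e t)) (- s e).
  by move=> /(glue_bwd phi0 phil); apply; near=> h; rewrite /phi; ring.
exists (glue u phi); split.
- by move=> e; split=> t tl; [exists (s e); exact: gf|exists (- s e); exact: gb].
- move=> v; rewrite /laplacian /= /vlap; congr (- (_ + _)); apply: eq_bigr => e _.
    by apply/slope_fwdE/gf; rewrite lexx len_gt0.
  by rewrite -opprB mulNr; apply/slope_bwdE/gb; rewrite lexx len_gt0.
- move=> [[e t] /= tl]; rewrite /laplacian /=; case/andP: tl => t0 tl.
  rewrite (slope_fwdE (gf e t _)) ?(ltW t0) // (slope_bwdE (gb e t _)) ?t0 ?(ltW tl) //.
  by rewrite subrr oppr0.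
Unshelve. all: by end_near. Qed.

(** A tent on the edge of [x] with its peak at [x] has a unit mass there, balanced by masses
    [- (1 - k)] at the source and [- k] at the target. *)
Lemma tent (x : {x : edge G * R | 0 < x.2 < len x.1}) : exists f,
  [/\ locally_linear f, forall y, laplacian f (inr y) = (y == x)%:R
    & \sum_v laplacian f (inl v) = -1].
Proof.
case: x => -[e0 t0] /= xl; have /andP[t0_gt0 t0_lt] := xl.
have l0 := len_gt0 e0.
(* Makes the descending side [t0 - k * t] vanish at the target, while the slopes [1 - k] and [- k]
   differ by 1. *)
pose k := t0 / len e0.
have k0 : 0 < k by rewrite divr_gt0.
have k1 : k < 1 by rewrite ltr_pdivrMr // mul1r.
have kl : k * len e0 = t0 by rewrite /k; field; rewrite gt_eqF.
pose phi e t : R := if e == e0 then if t <= t0 then t * (1 - k) else t0 - k * t else 0.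
have phi0 e : phi e 0 = 0 by rewrite /phi (ltW t0_gt0) mul0r; case: ifP.
have phil e : phi e (len e) = 0.
  by rewrite /phi; case: eqP => // ->; rewrite leNgt t0_lt /= kl subrr.
have phit : t0 - k * t0 = t0 * (1 - k) by ring.
pose F := glue (fun=> 0) phi.
pose sf e t := if e == e0 then if t < t0 then 1 - k else - k else 0.
pose sb e t := if e == e0 then if t <= t0 then - (1 - k) else k else 0.
have gf e t : 0 <= t < len e -> germ (fun h => F (edge_pt e (t + h))) (F (edge_pt e t)) (sf e t).
  move=> /(@glue_fwd (fun=> 0) phi phi0 phil); apply; rewrite /phi /sf; case: eqP => _; last exact: germ_cst.
  apply/germ_ex; have [tt|tt] := ltP t t0.
    exists (t0 - t); first by rewrite subr_gt0.
    by move=> h hh; rewrite (ltW tt) ifT; [ring|lra].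
  exists 1 => // h /andP[h0 _]; rewrite ifF; last by apply/negbTE; rewrite -ltNge; lra.
  by case: leP => t0t; [rewrite (_ : t = t0); [ring|lra]|ring].
have gb e t : 0 < t <= len e -> germ (fun h => F (edge_pt e (t - h))) (F (edge_pt e t)) (sb e t).
  move=> /(@glue_bwd (fun=> 0) phi phi0 phil); apply; rewrite /phi /sb; case: eqP => _; last exact: germ_cst.
  apply/germ_ex; have [tt|tt] := leP t t0.
    by exists 1 => // h hh; rewrite ifT; [ring|lra].
  exists (t - t0); first by rewrite subr_gt0.
  by move=> h hh; rewrite ifF; [ring|apply/negbTE; rewrite -ltNge; lra].
exists F; split.
- by move=> e; split=> t tl; [exists (sf e t); exact: gf|exists (sb e t); exact: gb].
- move=> [[e t] /= tl]; rewrite /laplacian /= -val_eqE /= xpair_eqE; case/andP: tl => t_0 tl.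
  rewrite (slope_fwdE (gf e t _)) ?(ltW t_0) // (slope_bwdE (gb e t _)) ?t_0 ?(ltW tl) //.
  rewrite /sf /sb; case: eqP => _ /=; last by rewrite addr0 oppr0.
  by case: ltgtP => _ /=; ring.
- rewrite /laplacian sumrN /= sum_ends (bigD1 e0) //= big1 => [|e ee].
    rewrite (slope_fwdE (gf e0 0 _)) ?lexx // (slope_bwdE (gb e0 (len e0) _)) ?lexx ?l0 //.
    by rewrite /sf /sb eqxx t0_gt0 leNgt t0_lt /=; ring.
  rewrite (slope_fwdE (gf e 0 _)) ?lexx ?len_gt0 // (slope_bwdE (gb e (len e) _)) ?lexx ?len_gt0 //.
  by rewrite /sf /sb (negbTE ee) addr0.
Qed.

(** Induction on the interior points carrying mass: a multiple of a tent moves the mass of one of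
    them to the vertices, keeping the total, until only the vertex problem is left. *)
Lemma poisson (s : seq {x : edge G * R | 0 < x.2 < len x.1}) (m : gpoint G -> R) :
  uniq s -> (forall y, y \notin s -> m (inr y) = 0) ->
  \sum_v m (inl v) + \sum_(y <- s) m (inr y) = 0 ->
  exists2 f, locally_linear f & forall p, laplacian f p = m p.
Proof.
elim: s m => [|x s IH] m /=.
  move=> _ m0; rewrite big_nil addr0 => sm.
  (* The sign makes up for that of [vlap]. *)
  have [|u Hu] := vlap_surj (b := fun v => - m (inl v)); first by rewrite sumrN sm oppr0.
  have [f [F fv fx]] := interpolation u; exists f => // -[v|y].
    by rewrite fv Hu opprK.
  by rewrite fx m0.
move=> /andP[xs us] m0; rewrite big_cons => sm.
have [f [F fx fv]] := tent x.
(* The remaining mass vanishes at [x] and still has total 0. *)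
have [||g Lg Hg] := IH (fun p => m p - m (inr x) * laplacian f p) us.
- move=> y ys; rewrite fx; case: eqP => [->|yx]; first by rewrite mulr1 subrr.
  by rewrite mulr0 subr0 m0 // inE negb_or ys andbT; apply/eqP.
- rewrite !sumrB -!mulr_sumr fv.
  have -> : \sum_(y <- s) laplacian f (inr y) = 0.
    rewrite big_seq big1 // => y ys.
    by rewrite fx; case: eqP => // yx; rewrite -yx ys in xs.
  by rewrite -[RHS]sm; ring.
exists (fun q => g q + m (inr x) * f q).
  exact/locally_linearD/locally_linearZ.
move=> p; rewrite laplacianD ?laplacianZ ?Hg //; first by ring.
exact: locally_linearZ.
Qed.

(** Any list containing the interior support is allowed, so that two divisors can be summed over a
    common one. *)
Lemma eff_div_degree (d : R) (D : eff_div G d) (s : seq {x : edge G * R | 0 < x.2 < len x.1}) :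
  uniq s -> (forall y, D (inr y) != 0 -> y \in s) ->
  \sum_v D (inl v) + \sum_(y <- s) D (inr y) = d.
Proof.
move=> us Ds; rewrite -[RHS](coef_degree D).
pose r : seq (gpoint G) := [seq inl v | v <- enum (vertex G)] ++ [seq inr y | y <- s].
rewrite -(fsbig_widen [set` r]) //; last first.
  move=> [v|y] [_ /=]; rewrite mem_cat.
    by case; rewrite map_f // mem_enum.
  move=> H; apply: contrapT => /eqP /Ds ys; apply: H.
  by apply/orP; right; exact: map_f.
rewrite -fsbig_seq; last first.
  rewrite cat_uniq; apply/and3P; split.
  - by rewrite map_inj_uniq ?enum_uniq // => ? ? [].
  - by apply/hasPn => q /mapP[y _ ->]; apply/negP => /mapP[].
  - by rewrite map_inj_uniq // => ? ? [].
by rewrite big_cat /= !big_map [index_enum _]unlock.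
Qed.

Lemma eff_div_support (d : R) (D : eff_div G d) :
  exists s : seq {x : edge G * R | 0 < x.2 < len x.1}, forall y, D (inr y) != 0 -> y \in s.
Proof.
have /finite_seqP[s Hs] := coef_finite D.
exists (pmap (fun p : gpoint G => if p is inr y then Some y else None) s) => y Dy.
rewrite mem_pmap; apply/mapP; exists (inr y) => //.
by have : [set` s] (inr y) by rewrite -Hs.
Qed.

(** Equality of degrees is the solvability condition of the Poisson equation; hence [xget] in
    [potential] never falls back on its default. *)
Lemma potentialP (d : R) (D1 D2 : eff_div G d) :
  locally_linear (potential D1 D2) /\
  forall p, laplacian (potential D1 D2) p = D2 p - D1 p.
Proof.
suff [f F Hf] : exists2 f, locally_linear f & forall p, laplacian f p = D2 p - D1 p.
  rewrite /potential; case: xgetP => [g _ [/piecewise_linearP ? ?] //|/(_ f)[]].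
  by split; [exact/piecewise_linearP|].
have [[s1 H1] [s2 H2]] := (eff_div_support D1, eff_div_support D2).
have us := undup_uniq (s1 ++ s2).
have K1 y : D1 (inr y) != 0 -> y \in undup (s1 ++ s2).
  by move=> /H1 ?; rewrite mem_undup mem_cat; apply/orP; left.
have K2 y : D2 (inr y) != 0 -> y \in undup (s1 ++ s2).
  by move=> /H2 ?; rewrite mem_undup mem_cat; apply/orP; right.
apply: (poisson us) => [y ys|].
  have /eqP -> : D1 (inr y) == 0 by apply: contraNT ys => /K1.
  have /eqP -> : D2 (inr y) == 0 by apply: contraNT ys => /K2.
  by rewrite subrr.
rewrite !sumrB addrACA -opprD (eff_div_degree us K1) (eff_div_degree us K2) subrr //.
Qed.

Lemma potential_unique (d : R) (D1 D2 : eff_div G d) f : locally_linear f ->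
  (forall p, laplacian f p = D2 p - D1 p) ->
  exists c, forall q, potential D1 D2 q = f q + c.
Proof.
move=> F Hf; have [P HP] := potentialP D1 D2.
have L : locally_linear (fun q => potential D1 D2 q + -1 * f q).
  exact/locally_linearD/locally_linearZ.
have [v _] : exists v0 : vertex G, v0 \in predT.
  by apply/card_gt0P; exact: graph_nonempty.
exists (potential D1 D2 (inl v) + -1 * f (inl v)) => q.
have := @harmonic_locally_linear_cst _ L _ q (inl v) => <-; first by ring.
move=> p; rewrite laplacianD ?laplacianZ ?HP ?Hf //; first by ring.
exact: locally_linearZ.
Qed.

End Poisson.

(** * Divisors as functions modulo constants *)

Section Range.
Context {T : Type} {R : realType}.
Implicit Types (f : T -> R).

(** Ensures that [fmax] and [fmin] really bound [f]; in [fmax_le] and [fmin_ge] the point [q0] shows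
    that the range is nonempty. *)
Definition bounded_fun_on f := exists M, forall q, `|f q| <= M.

Lemma bounded_fun_onB f g : bounded_fun_on f -> bounded_fun_on g ->
  bounded_fun_on (fun q => f q - g q).
Proof.
move=> [M HM] [N HN]; exists (M + N) => q.
by rewrite (le_trans (ler_normB _ _)) // lerD.
Qed.

Lemma fmax_ub f q : bounded_fun_on f -> f q <= fmax f.
Proof.
move=> [M HM]; apply: ub_le_sup; last by exists q.
by exists M => _ [p _ <-]; apply: le_trans (ler_norm _) (HM p).
Qed.

Lemma fmin_lb f q : bounded_fun_on f -> fmin f <= f q.
Proof.
move=> [M HM]; apply: ge_inf; last by exists q.
by exists (- M) => _ [p _ <-]; have := HM p; rewrite ler_norml => /andP[].
Qed.

Lemma fmax_le f (q0 : T) b : (forall q, f q <= b) -> fmax f <= b.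
Proof.
by move=> H; apply: ge_sup; [exists (f q0), q0|move=> _ [p _ <-]].
Qed.

Lemma fmin_ge f (q0 : T) b : (forall q, b <= f q) -> b <= fmin f.
Proof.
by move=> H; apply: lb_le_inf; [exists (f q0), q0|move=> _ [p _ <-]].
Qed.

End Range.

(** * Charts: the metric and tropical segments in terms of functions *)

Section Chart.
Context {R : realType} {G : metric_graph R} {d : R}.
Implicit Types D E : eff_div G d.

Lemma gpoint_inhabited : exists q : gpoint G, True.
Proof.
have [v _] : exists v0 : vertex G, v0 \in predT.
  by apply/card_gt0P; exact: graph_nonempty.
by exists (inl v).
Qed.

Lemma eff_div_ext D1 D2 : (forall p, D1 p = D2 p) -> D1 = D2.
Proof.
case: D1 D2 => [f1 a1 b1 c1] [f2 a2 b2 c2] /= /funext e.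
by subst f2; congr EffDiv; exact: Prop_irrelevance.
Qed.

Variable D0 : eff_div G d.

(** The additive constant is whatever [potential] picked, which is why the statements on charts
    quantify over constants. *)
Definition chart D : gpoint G -> R := potential D0 D.

Lemma chart_locally_linear D : locally_linear (chart D).
Proof. by have [] := potentialP D0 D. Qed.

Lemma chart_bounded D : bounded_fun_on (chart D).
Proof. exact/locally_linear_bounded/chart_locally_linear. Qed.

Lemma laplacian_chart D p : laplacian (chart D) p = D p - D0 p.
Proof. by have [] := potentialP D0 D. Qed.

Lemma potential_chart D1 D2 :
  exists c, forall q, potential D1 D2 q = chart D2 q - chart D1 q + c.
Proof.
have [|p|c Hc] := @potential_unique _ _ _ D1 D2 (fun q => chart D2 q + -1 * chart D1 q).
- by apply: locally_linearD; [|apply: locally_linearZ]; exact: chart_locally_linear.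
- rewrite laplacianD ?laplacianZ ?laplacian_chart; first by ring.
  + exact: chart_locally_linear.
  + exact: chart_locally_linear.
  + by apply: locally_linearZ; exact: chart_locally_linear.
- by exists c => q; rewrite Hc; ring.
Qed.

(** A divisor is [D0] plus the Laplacian of its chart, and the Laplacian ignores constants. *)
Lemma chart_inj D1 D2 c : (forall q, chart D1 q = chart D2 q + c) -> D1 = D2.
Proof.
move=> H; apply: eff_div_ext => p.
apply: (addIr (- D0 p)); rewrite -!laplacian_chart.
have -> : chart D1 = fun q => chart D2 q + c by exact/funext.
rewrite laplacianD ?laplacian_cst ?addr0 //; last exact: locally_linear_cst.
exact: chart_locally_linear.
Qed.

Lemma rho_le D1 D2 a b : (forall q, a <= chart D2 q - chart D1 q <= b) ->
  rho D1 D2 <= b - a.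
Proof.
move=> H; have [c Hc] := potential_chart D1 D2; have [q0 _] := gpoint_inhabited.
rewrite /rho; have : fmax (potential D1 D2) <= b + c.
  by apply: (fmax_le q0) => q; rewrite Hc lerD2r; case/andP: (H q).
have : a + c <= fmin (potential D1 D2).
  by apply: (fmin_ge q0) => q; rewrite Hc lerD2r; case/andP: (H q).
lra.
Qed.

Lemma potential_bounded D1 D2 : bounded_fun_on (potential D1 D2).
Proof. by apply: locally_linear_bounded; have [] := potentialP D1 D2. Qed.

(** A band of width exactly [rho]. Together with [rho_le], it reduces metric estimates to
    inequalities between charts. *)
Lemma rho_ex D1 D2 :
  exists a, forall q, a <= chart D2 q - chart D1 q <= a + rho D1 D2.
Proof.
have [c Hc] := potential_chart D1 D2; exists (fmin (potential D1 D2) - c) => q.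
have := fmin_lb q (potential_bounded D1 D2).
have := fmax_ub q (potential_bounded D1 D2).
by rewrite /rho Hc; lra.
Qed.

Lemma rho_triangle D1 D2 D3 : rho D1 D3 <= rho D1 D2 + rho D2 D3.
Proof.
have [[a Ha] [b Hb]] := (rho_ex D1 D2, rho_ex D2 D3).
have -> : rho D1 D2 + rho D2 D3 = (a + rho D1 D2 + (b + rho D2 D3)) - (a + b) by ring.
by apply: rho_le => q; have := Ha q; have := Hb q; lra.
Qed.

Lemma rho_refl D : rho D D = 0.
Proof.
have [a Ha] := rho_ex D D; have [q _] := gpoint_inhabited.
apply/le_anti/andP; split; last by have := Ha q; lra.
by rewrite -(subrr 0); apply: rho_le => p; rewrite subrr lexx.
Qed.

Lemma rho_ball D (e : R) : 0 < e -> nbhs D [set D' | rho D D' < e].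
Proof.
move=> e0; exists [set D' | rho D D' < e]; split => //=; last by rewrite rho_refl.
move=> D' /= D'e; exists (e - rho D D'); first by rewrite subr_gt0.
move=> D'' /=; have := rho_triangle D D' D''; lra.
Qed.

Lemma nbhs_rho D (A : set (eff_div G d)) : nbhs D A ->
  exists2 e : R, 0 < e & [set D' | rho D D' < e] `<=` A.
Proof.
move=> [B [oB BD BA]]; have [e e0 He] := oB D BD.
by exists e => // D' /He/BA.
Qed.

Lemma tpath_chart D1 D2 D t : coef D = tpath D1 D2 t ->
  exists k, forall q, chart D q = chart D1 q
    + Num.min (t * rho D1 D2) (potential D1 D2 q - fmin (potential D1 D2)) + k.
Proof.
move=> Dt; set m := fmin _.
have Lf : locally_linear (fun q => Num.min (t * rho D1 D2) (potential D1 D2 q - m)).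
  apply: locally_linear_min; first exact: locally_linear_cst.
  by apply: locally_linearD (locally_linear_cst _); have [] := potentialP D1 D2.
apply: potential_unique => [|p].
  by apply: locally_linearD => //; exact: chart_locally_linear.
rewrite laplacianD ?laplacian_chart //; last exact: chart_locally_linear.
by rewrite Dt /tpath -/m; ring.
Qed.

Lemma tpath_chart_min D1 D2 D t : coef D = tpath D1 D2 t ->
  exists a b, forall q, chart D q = Num.min (chart D1 q + a) (chart D2 q + b).
Proof.
move=> /tpath_chart[k Hk]; have [c Hc] := potential_chart D1 D2.
exists (t * rho D1 D2 + k), (c - fmin (potential D1 D2) + k) => q.
by rewrite Hk addr_minr addr_minl Hc; congr Num.min; ring.
Qed.

(** Converse of [tpath_chart_min]. The relative shift [a - b + c] is compared with the range of the
    potential: outside it one chart dominates everywhere, inside it is the truncation level of a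
    point of the segment. *)
Lemma tropically_convex_min (X : set (eff_div G d)) D1 D2 a b :
  tropically_convex X -> X D1 -> X D2 -> exists2 D, X D &
    exists c, forall q, chart D q = Num.min (chart D1 q + a) (chart D2 q + b) + c.
Proof.
move=> cX X1 X2; have [c Hc] := potential_chart D1 D2.
set m := fmin (potential D1 D2).
have mP q : m <= potential D1 D2 q := fmin_lb q (potential_bounded D1 D2).
have MP q : potential D1 D2 q <= m + rho D1 D2.
  by rewrite /rho -/m addrC subrK; exact: fmax_ub (potential_bounded D1 D2).
have [lo|lo] := leP (a - b + c) m.
  exists D1 => //; exists (- a) => q; rewrite min_l; first by ring.
  by have := mP q; rewrite Hc; lra.
have [hi|hi] := leP (m + rho D1 D2) (a - b + c).
  exists D2 => //; exists (- b) => q; rewrite min_r; first by ring.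
  by have := MP q; rewrite Hc; lra.
have r0 : 0 < rho D1 D2 by lra.
(* The parameter at which the truncation height [t * rho D1 D2] equals the shift measured from the
   minimum [m]. *)
pose t := (a - b + c - m) / rho D1 D2.
have tr : t * rho D1 D2 = a - b + c - m by rewrite /t; field; rewrite gt_eqF.
have [|D XD Dt] := cX D1 D2 X1 X2 (tpath D1 D2 t).
  exists t => //=; rewrite in_itv /= /t ler_pdivlMr // ler_pdivrMr //; lra.
exists D => //; have [k Hk] := tpath_chart Dt.
exists (k - b + c - m) => q.
by rewrite Hk -/m tr Hc addr_minr !addr_minl; congr Num.min; ring.
Qed.

End Chart.

(** * Projection and retraction *)

Section Speed.
Context {R : realType}.
Implicit Types t x : R.

(* With [y = x - travel t x], one has [1 + y = (1 + x) / max 1 (t (1 + x))],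
   that is, [y = min x ((1 - t) / t)], without a singularity at [t = 0]. *)
Definition travel t x : R := (1 + x) * (1 - (Num.max 1 (t * (1 + x)))^-1).

Lemma travel_eq0 t x : t * (1 + x) <= 1 -> travel t x = 0.
Proof. by move=> H; rewrite /travel max_l // invr1 subrr mulr0. Qed.

Lemma travel1 x : 0 <= x -> travel 1 x = x.
Proof.
move=> x0; rewrite /travel mul1r max_r ?lerDl //.
by field; rewrite gt_eqF // ltr_pwDl.
Qed.

Lemma travel_level t x y : 0 <= t -> y <= x - travel t x -> t * (1 + y) <= 1.
Proof.
move=> t0 yx; set m := Num.max 1 (t * (1 + x)).
have m0 : 0 < m by rewrite /m lt_max ltr01.
apply: (@le_trans _ _ (t * ((1 + x) / m))).
  apply: ler_wpM2l => //; move: yx; rewrite /travel -/m; lra.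
by rewrite mulrA ler_pdivrMr // mul1r /m le_max lexx orbT.
Qed.

Lemma travel_le t x : t <= 1 -> 0 <= x -> travel t x <= x.
Proof.
move=> t1 x0; set m := Num.max 1 (t * (1 + x)).
have m0 : 0 < m by rewrite /m lt_max ltr01.
suff : 1 <= (1 + x) / m by rewrite /travel -/m; lra.
rewrite ler_pdivlMr // mul1r /m ge_max lerDl x0 /=.
by rewrite -[leRHS]mul1r ler_wpM2r // addr_ge0.
Qed.

(** Joint continuity, including at time 0, since the denominator is at least 1. *)
Lemma travel_cvg (S : Type) (F : set_system S) {FF : Filter F} (f g : S -> R) t x :
  f @ F --> t -> g @ F --> x -> travel (f z) (g z) @[z --> F] --> travel t x.
Proof.
move=> ft gx.
have c1 : (1 + g z) @[z --> F] --> 1 + x by apply: cvgD => //; exact: cvg_cst.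
apply: cvgM => //; apply: cvgB; first exact: cvg_cst.
apply: cvgV; first by rewrite gt_eqF // lt_max ltr01.
rewrite maxr_absE; under eq_fun do rewrite maxr_absE.
have c2 : (f z * (1 + g z)) @[z --> F] --> t * (1 + x) by exact: cvgM.
apply: cvgM; last exact: cvg_cst.
apply: cvgD; first by apply: cvgD => //; exact: cvg_cst.
by apply: cvg_norm; apply: cvgB => //; exact: cvg_cst.
Qed.

End Speed.

(** * The least function of a compact convex set above a given one *)

Section Projection.
Context {R : realType} {G : metric_graph R} {d : R}.
Implicit Types D E : eff_div G d.
Variables (D0 : eff_div G d) (T : set (eff_div G d)).
Local Notation F := (chart D0).
Hypotheses (T0 : T !=set0) (cT : compact T) (tT : tropically_convex T).

(** Dominating translates are directed downwards by convexity, so the elements of [T] whose tight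
    translate lies below a given one generate a proper filter; a cluster point of it is the
    minimizer. *)
Lemma least_dominating D : exists Ec : eff_div G d * R,
  [/\ T Ec.1, forall q, F D q <= F Ec.1 q + Ec.2
    & forall E c, T E -> (forall q, F D q <= F E q + c) ->
      forall q, F Ec.1 q + Ec.2 <= F E q + c].
Proof.
(* The least shift that lifts [F E] above [F D]. *)
pose c E := fmax (fun q => F D q - F E q).
have bd E : bounded_fun_on (fun q => F D q - F E q).
  by apply: bounded_fun_onB; exact: chart_bounded.
have cP E q : F D q <= F E q + c E by rewrite -lerBlDl; exact: (fmax_ub q (bd E)).
have [q0 _] := @gpoint_inhabited R G.
have cle E k : (forall q, F D q <= F E q + k) -> c E <= k.
  by move=> H; apply: (fmax_le q0) => q; rewrite lerBlDl.
pose B := [set Ec : eff_div G d * R | T Ec.1 /\ forall q, F D q <= F Ec.1 q + Ec.2].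
pose K (Ec : eff_div G d * R) := [set E | T E /\ forall q, F E q + c E <= F Ec.1 q + Ec.2].
have BK i : B i -> K i i.1.
  by move=> [Ti iP]; split => // q; rewrite lerD2l; exact: cle.
have FF : Filter (filter_from B K).
  apply: filter_from_filter.
    by have [E TE] := T0; exists (E, c E); split => // q; exact: cP.
  move=> [E1 c1] [E2 c2] [/= T1 H1] [/= T2 H2].
  (* The minimum of two dominating translates is again one, and anything below it is below both. *)
  have [E TE [k Hk]] := tropically_convex_min D0 c1 c2 tT T1 T2.
  have kE q : F E q - k = Num.min (F E1 q + c1) (F E2 q + c2) by rewrite Hk addrK.
  exists (E, - k); first by split => //= q; rewrite kE le_min H1 H2.
  move=> E' [/= TE' HE']; split; split => //= q; apply: le_trans (HE' q) _;
    by rewrite kE ge_min lexx ?orbT.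
have FP : ProperFilter (filter_from B K).
  by apply: filter_from_proper => i Bi; exists i.1; exact: BK.
have FT : filter_from B K T.
  have [E TE] := T0; exists (E, c E); first by split => // q; exact: cP.
  by move=> ? [].
have [E [TE Ecl]] := cT FP FT.
exists (E, c E); split => // E1 c1 T1 H1 q.
apply/ler_addgt0Pr => e e0 /=.
have FK : filter_from B K (K (E1, c1)) by exists (E1, c1).
have [E2 [[T2 H2] /= E2e]] := Ecl _ _ FK (rho_ball D0 E e0).
have [a Ha] := rho_ex D0 E E2.
(* The tight shift of the cluster point is compared with that of a nearby [E2] in the filter set;
   altogether this costs at most [rho E E2 < e]. *)
have cE : c E <= a + rho E E2 + c E2.
  by apply: cle => p; have := cP E2 p; have := Ha p; lra.
have := H2 q; have := Ha q; rewrite /=; lra.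
Qed.

End Projection.

(** * The flow towards the projection *)

Section Retraction.
Context {R : realType} {G : metric_graph R} {d : R}.
Implicit Types D E : eff_div G d.
Variables (X T : set (eff_div G d)) (D0 : eff_div G d).
Local Notation F := (chart D0).
Hypotheses (tX : tropically_convex X) (TX : T `<=` X) (tT : tropically_convex T).
Variables (pr : eff_div G d -> eff_div G d * R).
Hypothesis prP : forall D, [/\ T (pr D).1, forall q, F D q <= F (pr D).1 q + (pr D).2
    & forall E c, T E -> (forall q, F D q <= F E q + c) ->
      forall q, F (pr D).1 q + (pr D).2 <= F E q + c].

Definition upper D q := F (pr D).1 q + (pr D).2.

Lemma upper_ge D q : F D q <= upper D q.
Proof. by have [] := prP D. Qed.

Lemma upper_least D E c : T E -> (forall q, F D q <= F E q + c) ->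
  forall q, upper D q <= F E q + c.
Proof. by have [_ _] := prP D; apply. Qed.

(** The function [upper D' + k] is itself a translate from [T] above [F D], so leastness applies. *)
Lemma upper_mono D D' k : (forall q, F D q <= F D' q + k) ->
  forall q, upper D q <= upper D' q + k.
Proof.
move=> H q; rewrite /upper -addrA; apply: upper_least; first by have [] := prP D'.
by move=> p; rewrite addrA; apply: le_trans (H p) _; rewrite lerD2r upper_ge.
Qed.

Lemma upper_id D q : T D -> upper D q = F D q.
Proof.
move=> TD; apply/le_anti; rewrite upper_ge andbT.
by rewrite -[leRHS]addr0; apply: upper_least => // p; rewrite addr0.
Qed.

(** By leastness [upper D - F D] has infimum 0, so this is the [rho] distance from [D] to its
    projection. *)
Definition gap D := fmax (fun q => upper D q - F D q).

Lemma upper_le_gap D q : upper D q <= F D q + gap D.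
Proof.
rewrite -lerBlDl; apply: (fmax_ub q); apply: bounded_fun_onB; last exact: chart_bounded.
have [M HM] := chart_bounded D0 (pr D).1; exists (M + `|(pr D).2|) => p.
by rewrite (le_trans (ler_normD _ _)) // lerD2r.
Qed.

Lemma gap_le D b : (forall q, upper D q <= F D q + b) -> gap D <= b.
Proof.
move=> H; have [q0 _] := @gpoint_inhabited R G.
by apply: (fmax_le q0) => q; rewrite lerBlDl.
Qed.

Lemma gap_ge0 D : 0 <= gap D.
Proof.
have [q0 _] := @gpoint_inhabited R G.
by rewrite -(lerD2l (F D q0)) addr0 (le_trans (upper_ge D q0)) // upper_le_gap.
Qed.

Lemma gap0 D : T D -> gap D = 0.
Proof.
move=> TD; apply/le_anti; rewrite gap_ge0 andbT.
by apply: gap_le => q; rewrite addr0 upper_id.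
Qed.

(** By monotonicity [upper D' - upper D] lies in the same band of width [rho D D'] as
    [F D' - F D]. *)
Lemma gap_lipschitz D D' : `|gap D - gap D'| <= rho D D'.
Proof.
have [a Ha] := rho_ex D0 D D'.
have U1 : forall q, upper D' q <= upper D q + (a + rho D D').
  by apply: upper_mono => q; have := Ha q; lra.
have U2 : forall q, upper D q <= upper D' q + (- a).
  by apply: upper_mono => q; have := Ha q; lra.
have : gap D <= gap D' + rho D D'.
  by apply: gap_le => q; have := Ha q; have := U2 q; have := upper_le_gap D' q; lra.
have : gap D' <= gap D + rho D D'.
  by apply: gap_le => q; have := Ha q; have := U1 q; have := upper_le_gap D q; lra.
by rewrite ler_norml; lra.
Qed.

Lemma gap_cvg D : gap @ D --> gap D.
Proof.
apply/(@cvgrPdist_lt _ _ _ (nbhs D) (nbhs_filter D)) => e e0.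
apply: (@filterS _ (nbhs D) (nbhs_filter D) _ _ _ (rho_ball D0 D e0)) => D' /=.
exact: le_lt_trans (gap_lipschitz D D').
Qed.

(** The minimum of the shifted [upper D1] and [upper D2] comes from [T] and dominates [F D], hence
    lies above [upper D]; it exceeds [F D] by at most the larger gap. *)
Lemma gap_min D D1 D2 a b :
  (forall q, F D q = Num.min (F D1 q + a) (F D2 q + b)) ->
  gap D <= Num.max (gap D1) (gap D2).
Proof.
move=> H; have [T1 T2] : T (pr D1).1 /\ T (pr D2).1 by split; [have [] := prP D1|have [] := prP D2].
have [E TE [k Hk]] := tropically_convex_min D0 ((pr D1).2 + a) ((pr D2).2 + b) tT T1 T2.
have kE q : F E q - k = Num.min (upper D1 q + a) (upper D2 q + b).
  by rewrite Hk addrK !addrA.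
apply: gap_le => q; apply: le_trans (upper_least (c := - k) TE _ q) _.
  move=> p; rewrite kE H le_min !ge_min !lerD2r !upper_ge /= orbT //.
rewrite kE H addr_minl le_min; set M := Num.max _ _.
have M1 : gap D1 <= M by rewrite le_max lexx.
have M2 : gap D2 <= M by rewrite le_max lexx orbT.
apply/andP; split; rewrite ge_min; apply/orP; [left|right].
  by have := upper_le_gap D1 q; lra.
by have := upper_le_gap D2 q; lra.
Qed.

Definition moved (t : R) D q := Num.min (F D q + travel t (gap D)) (upper D q).

(** For [z.2] in [X], convexity makes the set nonempty and injectivity of the chart makes it a
    singleton. *)
Definition flow (z : R * eff_div G d) : eff_div G d :=
  xget z.2 [set D | X D /\ exists c, forall q, F D q = moved z.1 z.2 q + c].

Lemma flowP t D : X D ->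
  X (flow (t, D)) /\ exists c, forall q, F (flow (t, D)) q = moved t D q + c.
Proof.
move=> XD; have TD : X (pr D).1 by apply: TX; have [] := prP D.
have [E XE [c Hc]] := tropically_convex_min D0 (travel t (gap D)) (pr D).2 tX XD TD.
rewrite /flow; case: xgetP => [E' _ //|/(_ E)[]].
by split => //; exists c.
Qed.

Lemma flow_eq t D E c : X D -> (forall q, F E q = moved t D q + c) -> flow (t, D) = E.
Proof.
move=> XD H; have [_ [k Hk]] := flowP t XD.
by apply: (@chart_inj _ _ _ D0 _ _ (k - c)) => q; rewrite Hk H; ring.
Qed.

(** Serves three times: at time 0, on [T], and to recognize the image at time [t] as a sublevel set
    of [gap]. *)
Lemma flow_fix t D : X D -> t * (1 + gap D) <= 1 -> flow (t, D) = D.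
Proof.
move=> XD H; apply: (flow_eq (c := 0)) => // q.
by rewrite /moved travel_eq0 // !addr0 min_l // upper_ge.
Qed.

Lemma flow1 D : X D -> flow (1, D) = (pr D).1.
Proof.
move=> XD; apply: (flow_eq (c := - (pr D).2)) => // q.
rewrite /moved travel1 ?gap_ge0 // min_r ?upper_le_gap // /upper; ring.
Qed.

(** Moving stays below [upper D], so the upper function does not rise, while the chart climbs: at
    most [gap D - travel t (gap D)] remains. *)
Lemma gap_flow t D : 0 <= t <= 1 -> X D -> t * (1 + gap (flow (t, D))) <= 1.
Proof.
case/andP=> t0 t1 XD; have [_ [c Hc]] := flowP t XD.
apply: (@travel_level _ t (gap D)) => //; apply: gap_le => q.
have TD : T (pr D).1 by have [] := prP D.
apply: (@le_trans _ _ (upper D q + c)).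
  rewrite /upper -addrA; apply: upper_least => // p.
  by rewrite Hc addrA lerD2r /moved ge_min lexx orbT.
rewrite Hc [leRHS]addrAC lerD2r /moved addr_minl le_min.
have := travel_le t1 (gap_ge0 D); have := upper_le_gap D q; lra.
Qed.

(** Charts and upper functions move within one common band; the change of the travelled amount
    widens it by its absolute value on either side, and minima preserve it. *)
Lemma rho_flow t t' D D' : X D -> X D' -> rho (flow (t, D)) (flow (t', D')) <=
  rho D D' + 2 * `|travel t (gap D) - travel t' (gap D')|.
Proof.
move=> XD XD'; have [_ [c Hc]] := flowP t XD; have [_ [c' Hc']] := flowP t' XD'.
have [a Ha] := rho_ex D0 D D'.
have U1 : forall q, upper D' q <= upper D q + (a + rho D D').
  by apply: upper_mono => q; have := Ha q; lra.
have U2 : forall q, upper D q <= upper D' q + (- a).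
  by apply: upper_mono => q; have := Ha q; lra.
set s := travel t _; set s' := travel t' _.
have [s1 s2] : s - s' <= `|s - s'| /\ s' - s <= `|s - s'|.
  by rewrite ler_norm distrC ler_norm.
have r0 := normr_ge0 (s - s').
have -> : rho D D' + 2 * `|s - s'| = (a + rho D D' + `|s - s'| + c' - c)
    - (a - `|s - s'| + c' - c) by ring.
apply: (rho_le (D0 := D0)) => q; rewrite Hc Hc' /moved -/s -/s'.
have := U1 q; have := U2 q; have := Ha q.
case: (leP (F D q + s)); case: (leP (F D' q + s')); lra.
Qed.

Lemma flow_continuous : {within `[0, 1] `*` X, continuous flow}.
Proof.
apply/subspace_continuousP => -[t D] [/= _ XD] A /(nbhs_rho)[e e0 eA].
pose f (z : R * eff_div G d) := travel z.1 (gap z.2).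
have fc : f @ nbhs (t, D) --> travel t (gap D).
  apply: travel_cvg; first exact: cvg_fst.
  exact: cvg_comp cvg_snd (@gap_cvg D).
(* The travel difference counts twice in [rho_flow], so a quarter and a half add up to [e]. *)
have e4 : 0 < e / 4 by rewrite divr_gt0.
have e2 : 0 < e / 2 by rewrite divr_gt0.
rewrite /= /nbhs /= /within.
have : \forall z \near (t, D), rho D z.2 < e / 2.
  exact: cvg_snd (rho_ball D0 D e2).
have /cvgrPdist_lt/(_ _ e4) := fc.
rewrite near_simpl /=; apply: filterS2 => -[t' D'] /= H1 H2 [_ XD'].
apply: eA => /=; apply: le_lt_trans (rho_flow t t' XD XD') _.
by move: H1 H2; rewrite /f /=; lra.
Qed.

Lemma flow_retraction : tropical_retraction X T flow.
Proof.
split.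
- exact: flow_continuous.
- by move=> t D _ XD; have [] := flowP t XD.
- move=> D XD; split; first by apply: flow_fix; rewrite ?mul0r.
  by rewrite flow1 //; have [] := prP D.
- move=> t D /andP[_ t1] TD; apply: flow_fix; first exact: TX.
  by rewrite gap0 // addr0 mulr1.
- move=> t t01 _ _ [D1 X1 <-] [D2 X2 <-] f.
  have [Y1 _] := flowP t X1; have [Y2 _] := flowP t X2.
  move=> tf; have [D XD Df] := tX Y1 Y2 tf.
  case: tf => s _ sf; have [a [b Hab]] := tpath_chart_min D0 (etrans Df (esym sf)).
  (* The point [D] of the segment is its own preimage: its gap is at most the larger of the gaps of
     the ends, which already satisfy the level bound. *)
  exists D => //; exists D => //; apply: flow_fix => //.
  case/andP: (t01) => t0 _.
  have [g1|g2] := leP (gap (flow (t, D1))) (gap (flow (t, D2))).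
    apply: le_trans (gap_flow t01 X2); rewrite ler_wpM2l // lerD2l.
    by apply: le_trans (gap_min Hab) _; rewrite max_r.
  apply: le_trans (gap_flow t01 X1); rewrite ler_wpM2l // lerD2l.
  by apply: le_trans (gap_min Hab) _; rewrite max_l // ltW.
Qed.

End Retraction.

Theorem theorem8p5 (R : realType) (G : metric_graph R) (d : R) (hd : 0 <= d)
    (X : set (eff_div G d)) (hX : tropically_convex X)
    (T : set (eff_div G d)) (hTX : T `<=` X) (hT0 : T !=set0)
    (hTcompact : compact T) (hTconvex : tropically_convex T) :
  exists h : R * eff_div G d -> eff_div G d, tropical_retraction X T h.
Proof.
(* Any element of [T] can serve as the origin of the charts. *)
have [D0 _] := hT0.
have /choice[pr prP] := least_dominating D0 hT0 hTcompact hTconvex.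
by exists (flow X D0 pr); exact: flow_retraction.
Qed.
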